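(* Let $(M,g)$ be a smooth, closed, connected, non-orientable Riemannian manifold. Then $M$ has an orientable double covering $\widetilde M$, with nontrivial deck transformation $z$, that is embedded symmetrically inside $\mathbb{R}^p$ for some $p\in\mathbb{N}$; that is, there is a smooth embedding $\Phi:\widetilde M\hookrightarrow\mathbb{R}^p$ with $\Phi(z\circ x)=-\Phi(x)$ for all $x\in\widetilde M$.
   Context: The deck transformation group of the double covering is $\mathbb{Z}_2=\{1,z\}$, and $z\circ x$ denotes the action of $z$ on $x\in\widetilde M$. *)

(* Defs.v *)
From mathcomp Require Import all_boot all_order all_algebra.
From mathcomp Require Import all_classical all_reals all_analysis.

Set Implicit Arguments.
Unset Strict Implicit.
Unset Printing Implicit Defensive.

Import Order.TTheory GRing.Theory Num.Theory.
Import numFieldNormedType.Exports.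

Local Open Scope classical_set_scope.
Local Open Scope ring_scope.

(* [f] is of class C^k at every point of the open set [U]. Only meant for open
   [U]: differentiability and directional derivatives are those of the total
   function [f], which at points of an open set depend on [f] on [U] only. *)
Fixpoint Ck_on (R : realType) (n : nat) (W : normedModType R) (k : nat)
    (U : set 'rV[R]_n) (f : 'rV[R]_n -> W) : Prop :=
  match k with
  | 0 => forall p, U p -> {for p, continuous f}
  | k'.+1 => (forall p, U p -> differentiable f p) /\
             (forall v : 'rV[R]_n, Ck_on k' U (fun p => 'D_v f p))
  end.

Definition smooth_on (R : realType) (n : nat) (W : normedModType R)
    (U : set 'rV[R]_n) (f : 'rV[R]_n -> W) : Prop :=
  forall k, Ck_on k U f.

(* [chart_fun] and [chart_inv] are total functions whose values are only
   relevant on [chart_dom] and on its image respectively. *)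
Record chart (R : realType) (n : nat) (M : topologicalType) := Chart {
  chart_dom : set M;
  chart_fun :> M -> 'rV[R]_n;
  chart_inv : 'rV[R]_n -> M;
  chart_dom_open : open chart_dom;
  chart_img_open : open (chart_fun @` chart_dom);
  chart_funK : {in chart_dom, cancel chart_fun chart_inv};
  chart_fun_continuous :
    forall x, chart_dom x -> {for x, continuous chart_fun};
  chart_inv_continuous :
    forall p, (chart_fun @` chart_dom) p -> {for p, continuous chart_inv}
}.

Definition transition (R : realType) (n : nat) (M : topologicalType)
    (c d : chart R n M) : 'rV[R]_n -> 'rV[R]_n :=
  d \o chart_inv c.

Definition smooth_transition (R : realType) (n : nat) (M : topologicalType)
    (c d : chart R n M) : Prop :=
  smooth_on (c @` (chart_dom c `&` chart_dom d)) (transition c d).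

(* Smooth manifolds of dimension [n], without boundary. The atlas need not be
   maximal: it generates the smooth structure (see [smooth_chart]). *)
Record smoothManifold (R : realType) (n : nat) := SmoothManifold {
  manifold_sort :> topologicalType;
  manifold_hausdorff : hausdorff_space manifold_sort;
  manifold_second_countable : @second_countable manifold_sort;
  atlas : set (chart R n manifold_sort);
  atlas_cover : forall x, exists2 c, atlas c & chart_dom c x;
  atlas_compatible : forall c d, atlas c -> atlas d -> smooth_transition c d
}.

Definition smooth_chart (R : realType) (n : nat) (M : smoothManifold R n)
    (c : chart R n M) : Prop :=
  forall d, atlas d -> smooth_transition c d /\ smooth_transition d c.

Definition orientable (R : realType) (n : nat) (M : smoothManifold R n) : Prop :=
  exists A : set (chart R n M),
    [/\ A `<=` @smooth_chart R n M,
        forall x, exists2 c, A c & chart_dom c x &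
        forall c d x, A c -> A d -> chart_dom c x -> chart_dom d x ->
          0 < \det ('J (transition c d) (c x))].

(* A Riemannian metric given by its components: [gram c p] is the matrix of the
   inner product on the tangent space at [chart_inv c p] in the coordinate basis
   of [c]. As Jacobians act on row vectors, the components of a tangent vector
   change from [c] to [d] by [v *m J], whence [gram_change]. *)
Record riemannian_metric (R : realType) (n : nat) (M : smoothManifold R n) :=
    RiemannianMetric {
  gram : chart R n M -> 'rV[R]_n -> 'M[R]_n;
  gram_smooth : forall c, atlas c -> smooth_on (c @` chart_dom c) (gram c);
  gram_sym : forall c x, atlas c -> chart_dom c x ->
    (gram c (c x))^T = gram c (c x);
  gram_posdef : forall c x, atlas c -> chart_dom c x ->
    forall v : 'rV[R]_n, v != 0 -> 0 < (v *m gram c (c x) *m v^T) 0 0;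
  gram_change : forall c d x,
    atlas c -> atlas d -> chart_dom c x -> chart_dom d x ->
    let J := 'J (transition c d) (c x) in
    gram c (c x) = J *m gram d (d x) *m J^T
}.

(* Smoothness on an open subset [A] of [M]; continuity makes the coordinate
   domains below open. *)
Definition smooth_map_on (R : realType) (m n : nat) (M : smoothManifold R m)
    (N : smoothManifold R n) (A : set M) (f : M -> N) : Prop :=
  (forall x, A x -> {for x, continuous f}) /\
  forall (c : chart R m M) (d : chart R n N), atlas c -> atlas d ->
    smooth_on (c @` (A `&` chart_dom c `&` f @^-1` chart_dom d))
              (d \o f \o chart_inv c).

Definition diffeomorphism_on (R : realType) (m n : nat) (M : smoothManifold R m)
    (N : smoothManifold R n) (A : set M) (B : set N) (f : M -> N) : Prop :=
  exists g : N -> M,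
    [/\ smooth_map_on A f, smooth_map_on B g,
        forall x, A x -> B (f x) /\ g (f x) = x &
        forall y, B y -> A (g y) /\ f (g y) = y].

Definition double_covering (R : realType) (n : nat)
    (Mt M : smoothManifold R n) (pi : Mt -> M) : Prop :=
  forall x : M, exists (U : set M) (V1 V2 : set Mt),
    [/\ open U /\ U x, open V1 /\ open V2,
        V1 `&` V2 = set0, pi @^-1` U = V1 `|` V2 &
        diffeomorphism_on V1 U pi /\ diffeomorphism_on V2 U pi].

Definition homeomorphism (X Y : topologicalType) (f : X -> Y) : Prop :=
  exists g : Y -> X,
    [/\ continuous f, continuous g, cancel f g & cancel g f].

Definition deck_transformation (X Y : topologicalType) (pi : X -> Y)
    (d : X -> X) : Prop :=
  homeomorphism d /\ pi \o d = pi.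

(* Continuity, which the last two clauses need to make [f] a homeomorphism onto
   its image, follows from smoothness in charts. *)
Definition smooth_embedding (R : realType) (n p : nat) (M : smoothManifold R n)
    (f : M -> 'rV[R]_p) : Prop :=
  [/\ forall c : chart R n M, atlas c ->
        smooth_on (c @` chart_dom c) (f \o chart_inv c),
      forall (c : chart R n M) (x : M), atlas c -> chart_dom c x ->
        injective ('d (f \o chart_inv c) (c x)),
      injective f &
      forall A : set M, open A -> exists2 B, open B & A = f @^-1` B].

(* Main.v *)
(** The orientation cover of M consists of the pairs (x, o) with o one of the
    two orientations of M at x. Every smooth chart of M lifts to the points
    carrying the orientation that the chart induces, and two such lifts have a
    transition map of positive Jacobian determinant where they overlap, so the
    cover is orientable. Over a connected base the two-point fibres leave the
    identity and the swap z as the only deck transformations.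

    For the symmetric embedding, take finitely many charts c_i of M with bump
    functions b_i >= 0 supported in their domains, such that at each point some
    b_i is positive. Let s_i(x, o) = 1 or -1 according to whether c_i induces
    o at x. The map Phi = (s_i b_i, s_i b_i c_i)_i is odd under z and is smooth
    although s_i is only defined where c_i is. Where b_i > 0, the quotient of
    the last n entries of the i-th block by the first one recovers c_i, and the
    sign of the first one recovers o. This smooth local left inverse makes Phi
    an injective immersion and a homeomorphism onto its image. *)

From HB Require Import structures.
Require Import Defs.
From mathcomp Require Import all_boot all_order all_fingroup all_algebra.
From mathcomp Require Import all_classical all_reals all_analysis.
From mathcomp Require Import ring.

Set Implicit Arguments.
Unset Strict Implicit.
Unset Printing Implicit Defensive.

Import Order.TTheory GRing.Theory Num.Theory.
Import numFieldNormedType.Exports.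

Local Open Scope classical_set_scope.
Local Open Scope ring_scope.

(** * Calculus of class C^k maps *)

Section near_differentiable.
Context {K : numFieldType} {V W : normedModType K}.

(** Only values near [a] enter a first-order expansion, so that of [f] is also one of [g], and
    [diff_unique] identifies the two differentials. *)
Lemma near_eq_differentiable (f g : V -> W) (a : V) :
  {near a, f =1 g} -> differentiable f a -> differentiable g a.
Proof.
move=> fg fa.
have expansion : g \o shift a = cst (g a) + 'd f a +o_0 id.
  apply/eqaddoP => e e0.
  have [_ /eqaddoP/(_ e e0)] := (diff_locallyP a f).1 fa.
  have fg0 : \forall x \near (0 : V), f (x + a) = g (x + a).
    have := fg; rewrite (near_shift (0 : V)) /=.
    by apply: filterS => x /=; rewrite subr0.
  apply: filterS2 fg0 => x /= fgx.
  by rewrite !fctE /= fgx (nbhs_singleton fg).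
have gd := diff_unique (diff_continuous fa) expansion.
by apply/diff_locallyP; split; rewrite gd //; exact: diff_continuous.
Qed.

End near_differentiable.

Section Ck.
Context {R : realType} {n : nat}.
Local Notation E := 'rV[R]_n.
Implicit Types (U V : set E) (k : nat).

Lemma Ck_on_sub (W : normedModType R) k U V (f : E -> W) :
  V `<=` U -> Ck_on k U f -> Ck_on k V f.
Proof.
elim: k f => [|k IH] f VU /=; first by move=> Uf p /VU /Uf.
by move=> [df Df]; split=> [p /VU/df //|v]; exact: IH.
Qed.

(* [Ck_on] only constrains derivatives at the points of the set, so local
   regularity can be checked one point at a time, even though [[set p]] is not
   open. *)
Lemma Ck_on_pointwise (W : normedModType R) k U (f : E -> W) :
  (forall p, U p -> Ck_on k [set p] f) -> Ck_on k U f.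
Proof.
elim: k f => [|k IH] f /= Uf; first by move=> p /Uf; exact.
split=> [p /Uf[+ _]|v]; first exact.
by apply: IH => p /Uf[_]; exact.
Qed.

(** Openness of [U] turns equality on [U] into equality near each of its points, which directional
    derivatives inherit. *)
Lemma Ck_on_eq (W : normedModType R) k U (f g : E -> W) :
  open U -> (forall p, U p -> f p = g p) -> Ck_on k U f -> Ck_on k U g.
Proof.
move=> oU; elim: k f g => [|k IH] f g fg /=.
  move=> Uf p Up; have nfg : {near p, f =1 g}.
    by apply: filterS (open_nbhs_nbhs (conj oU Up)) => x /fg.
  rewrite /prop_for /continuous_at -(fg _ Up).
  exact: cvg_trans (near_eq_cvg nfg) (Uf _ Up).
have nfg p : U p -> {near p, f =1 g}.
  by move=> Up; apply: filterS (open_nbhs_nbhs (conj oU Up)) => x /fg.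
move=> [df Df]; split=> [p Up|v].
  by apply: near_eq_differentiable (df _ Up); exact: nfg.
by apply: IH (Df v) => p /nfg; exact: near_eq_derive.
Qed.

Lemma Ck_onW (W : normedModType R) k U (f : E -> W) :
  Ck_on k.+1 U f -> Ck_on k U f.
Proof.
elim: k f => [|k IH] f.
  by move=> [df _] p /df /differentiable_continuous.
by move=> [df Df]; split => // v; exact: IH.
Qed.

Lemma Ck_on_continuous (W : normedModType R) k U (f : E -> W) p :
  Ck_on k U f -> U p -> {for p, continuous f}.
Proof.
case: k => [Uf /Uf //|k [df _] /df]; exact: differentiable_continuous.
Qed.

Lemma Ck_on_cst (W : normedModType R) k U (a : W) : Ck_on k U (cst a).
Proof.
elim: k a => [|k IH] a /=; first by move=> p _; exact: cst_continuous.
split=> [p _|v]; first exact: differentiable_cst.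
rewrite (_ : (fun _ => _) = cst 0) //; apply/funext => p; exact: derive_cst.
Qed.

Lemma Ck_onD (W : normedModType R) k U (f g : E -> W) : open U ->
  Ck_on k U f -> Ck_on k U g -> Ck_on k U (f + g).
Proof.
move=> oU; elim: k f g => [|k IH] f g /=.
  by move=> Uf Ug p Up; apply: continuousD; [exact: Uf|exact: Ug].
move=> [df Df] [dg Dg]; split=> [p Up|v].
  by apply: differentiableD; [exact: df|exact: dg].
apply: Ck_on_eq (IH _ _ (Df v) (Dg v)) => // p Up.
by rewrite deriveD //; apply: diff_derivable; [exact: df|exact: dg].
Qed.

Lemma Ck_on_sum (W : normedModType R) k U (I : Type) (r : seq I) (P : pred I)
    (f : I -> E -> W) : open U ->
  (forall i, P i -> Ck_on k U (f i)) -> Ck_on k U (\sum_(i <- r | P i) f i).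
Proof.
move=> oU Uf; elim/big_ind : _ => //; first exact: Ck_on_cst.
by move=> g h; exact: Ck_onD.
Qed.

Lemma Ck_onM k U (f g : E -> R) : open U ->
  Ck_on k U f -> Ck_on k U g -> Ck_on k U (f * g).
Proof.
move=> oU; elim: k f g => [|k IH] f g.
  by move=> Uf Ug p Up; apply: continuousM; [exact: Uf|exact: Ug].
move=> Uf Ug; have [df Df] := Uf; have [dg Dg] := Ug; split=> [p Up|v].
  by apply: differentiableM; [exact: df|exact: dg].
apply: (@Ck_on_eq _ _ _
    (f * (fun p => 'D_v g p) + g * (fun p => 'D_v f p))) => //.
  move=> p Up; rewrite deriveM //; apply: diff_derivable; first exact: df.
  exact: dg.
(* The product rule keeps one factor undifferentiated, so the induction also needs [f] and [g]
   themselves at order [k]. *)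
have cf := Ck_onW Uf; have cg := Ck_onW Ug.
apply: Ck_onD => //; [exact: IH cf (Dg v)|exact: IH cg (Df v)].
Qed.

Lemma Ck_on_prod k U (I : Type) (r : seq I) (P : pred I) (f : I -> E -> R) :
  open U -> (forall i, P i -> Ck_on k U (f i)) ->
  Ck_on k U (\prod_(i <- r | P i) f i).
Proof.
move=> oU Uf; elim/big_ind : _ => //; first exact: Ck_on_cst.
by move=> g h; exact: Ck_onM.
Qed.

Lemma Ck_on_linear (W W' : normedModType R) k U (f : E -> W)
    (L : {linear W -> W'}) : open U -> continuous L ->
  Ck_on k U f -> Ck_on k U (L \o f).
Proof.
move=> oU cL; elim: k f => [|k IH] f /=.
  by move=> Uf p Up; apply: continuous_comp; [exact: Uf|exact: cL].
move=> [df Df]; split=> [p Up|v].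
  by apply: differentiable_comp; [exact: df|exact: linear_differentiable].
apply: Ck_on_eq (IH _ (Df v)) => // p Up /=; have dfp := df _ Up.
have dL : differentiable L (f p) by exact: linear_differentiable.
rewrite !deriveE //; last exact: differentiable_comp.
by rewrite (diff_comp dfp dL) /= diff_lin.
Qed.

End Ck.

Section coordinates.
Context {R : realType}.

Lemma linear_rV_continuous (m : nat) (W : normedModType R)
  (L : {linear 'rV[R]_m -> W}) : continuous L.
Proof.
have -> : (L : 'rV[R]_m -> W) =
    \sum_(j < m) (fun v : 'rV[R]_m => v 0 j *: L (delta_mx 0 j)).
  apply/funext => v; rewrite fct_sumE [in LHS](row_sum_delta v) linear_sum.
  by apply: eq_bigr => j _; rewrite linearZ.
move=> v; apply: (@Ck_on_continuous _ _ _ 0 setT) => //.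
apply: Ck_on_sum => [|j _ p _]; first exact: openT.
by apply: (@continuousZr_tmp _ _ _ (fun v : 'rV[R]_m => v 0 j));
  exact: coord_continuous.
Qed.

Context {n : nat}.
Local Notation E := 'rV[R]_n.
Implicit Types (U : set E) (k : nat).

Lemma Ck_on_linear_rV m (W : normedModType R) k U (f : E -> 'rV[R]_m)
    (L : {linear 'rV[R]_m -> W}) : open U ->
  Ck_on k U f -> Ck_on k U (L \o f).
Proof. by move=> oU; apply: Ck_on_linear => //; exact: linear_rV_continuous. Qed.

Lemma Ck_on_scalel (W : normedModType R) k U (a : E -> R) (w : W) :
  open U -> Ck_on k U a -> Ck_on k U (fun p => a p *: w).
Proof.
move=> oU Ua.
have lw : linear (fun x : R => x *: w).
  by move=> x y z; rewrite scalerDl scalerA.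
pose lwM := GRing.isLinear.Build _ _ _ _ _ lw.
pose L : {linear R -> W} := HB.pack (fun x : R => x *: w) lwM.
by apply: (@Ck_on_linear _ _ _ _ k U a L) => //; exact: scalel_continuous.
Qed.

Lemma Ck_on_coord m k U (f : E -> 'rV[R]_m) j : open U ->
  Ck_on k U f -> Ck_on k U (fun p => f p 0 j).
Proof.
move=> oU Uf.
have lj : linear (fun v : 'rV[R]_m => v 0 j) by move=> a u v; rewrite !mxE.
pose ljM := GRing.isLinear.Build _ _ _ _ _ lj.
pose L : {linear 'rV[R]_m -> R} := HB.pack (fun v : 'rV[R]_m => v 0 j) ljM.
exact: (@Ck_on_linear_rV _ _ k U f L).
Qed.

Lemma Ck_on_row m k U (f : E -> 'rV[R]_m) : open U ->
  (forall j, Ck_on k U (fun p => f p 0 j)) -> Ck_on k U f.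
Proof.
move=> oU Uf.
have -> : f = \sum_j (fun p => f p 0 j *: delta_mx 0 j).
  by apply/funext => p; rewrite fct_sumE -row_sum_delta.
by apply: Ck_on_sum => // j _; exact: Ck_on_scalel.
Qed.

Lemma Ck_onZ m k U (a : E -> R) (f : E -> 'rV[R]_m) : open U ->
  Ck_on k U a -> Ck_on k U f -> Ck_on k U (fun p => a p *: f p).
Proof.
move=> oU Ua Uf; apply: Ck_on_row => // j.
rewrite (_ : (fun _ => _) = a * (fun p => f p 0 j)); last first.
  by apply/funext => p; rewrite mxE.
by apply: Ck_onM => //; exact: Ck_on_coord.
Qed.

Lemma Ck_on_id k U : open U -> Ck_on k U (@id E).
Proof.
move=> oU; case: k => [|k] /=; first by move=> p _; exact: cvg_id.
split=> [p _|v]; first exact: ex_diff.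
rewrite (_ : (fun _ => _) = cst v); first exact: Ck_on_cst.
by apply/funext => p; rewrite derive_id.
Qed.

(** Induction on [k] by the chain rule in coordinates: a directional derivative of [g \o f] is a sum
    of products of coordinates of a derivative of [f] with partial derivatives of [g] composed with
    [f]. The scalar target puts these products within reach of [Ck_onM]. *)
Lemma Ck_on_comp_scalar m k U (V : set 'rV[R]_m) (f : E -> 'rV[R]_m)
    (g : 'rV[R]_m -> R) : open U -> (forall p, U p -> V (f p)) ->
  Ck_on k U f -> Ck_on k V g -> Ck_on k U (g \o f).
Proof.
move=> oU UV; elim: k g => [|k IH] g.
  move=> Uf Vg p Up; apply: continuous_comp; [exact: Uf|exact/Vg/UV].
move=> Uf Vg; have [df Df] := Uf; have [dg Dg] := Vg; split=> [p Up|v].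
  by apply: differentiable_comp; [exact: df|exact/dg/UV].
apply: (@Ck_on_eq _ _ _ _ _ (\sum_j (fun p => ('D_v f p) 0 j) *
    ((fun q => 'D_(delta_mx 0 j) g q) \o f))) => //; last first.
  apply: Ck_on_sum => // j _; apply: Ck_onM => //.
    exact: (Ck_on_coord j oU (Df v)).
  exact: IH (Ck_onW Uf) (Dg _).
move=> p Up; have dfp := df _ Up; have dgp := dg _ (UV _ Up).
rewrite fct_sumE deriveE; last exact: differentiable_comp.
rewrite (diff_comp dfp dgp) /= -(deriveE _ dfp).
rewrite [in RHS](row_sum_delta ('D_v f p)).
rewrite linear_sum; apply: eq_bigr => j _.
by rewrite linearZ -(deriveE _ dgp).
Qed.

End coordinates.

Lemma Ck_on_comp (R : realType) n m q k (U : set 'rV[R]_n) (V : set 'rV[R]_m)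
    (f : 'rV[R]_n -> 'rV[R]_m)
    (g : 'rV[R]_m -> 'rV[R]_q) : open U -> open V ->
    (forall p, U p -> V (f p)) ->
  Ck_on k U f -> Ck_on k V g -> Ck_on k U (g \o f).
Proof.
move=> oU oV UV Uf Vg; apply: Ck_on_row => // j.
apply: (@Ck_on_comp_scalar R n m k U V f (fun p => g p 0 j)) => //.
exact: (Ck_on_coord j oV Vg).
Qed.


(** * Jacobian matrices and their determinants *)

Section jacobian.
Context {R : realType}.

(** The Leibniz formula makes the determinant a polynomial in the entries of the Jacobian, which are
    coordinates of directional derivatives. *)
Lemma continuous_det_jacobian n (U : set 'rV[R]_n) (f : 'rV[R]_n -> 'rV[R]_n) p :
  open U -> Ck_on 1 U f -> U p -> {for p, continuous (fun q => \det ('J f q))}.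
Proof.
move=> oU Uf Up; have [df Df] := Uf.
apply: (@Ck_on_continuous _ _ _ 0 U) => //.
pose G (s : 'S_n) i q : R := ('D_(delta_mx 0 i) f q) 0 (s i).
apply: (@Ck_on_eq _ _ _ _ _ (\sum_(s : 'S_n)
    (fun q => (-1) ^+ s * \prod_i G s i q))) => //.
  move=> q Uq; rewrite fct_sumE /determinant; apply: eq_bigr => s _.
  congr (_ * _); apply: eq_bigr => i _.
  by rewrite /G (deriveEjacobian _ (df _ Uq)) -rowE mxE.
apply: Ck_on_sum => // s _.
have -> : (fun q => (-1) ^+ s * \prod_i G s i q) =
    cst ((-1) ^+ s) * \prod_i G s i by rewrite fct_prodE.
apply: Ck_onM => //; first exact: Ck_on_cst.
apply: Ck_on_prod => // i _.
exact: (@Ck_on_coord _ _ _ 0 U (fun q => 'D_(delta_mx 0 i) f q) (s i) oU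
  (Df (delta_mx 0 i))).
Qed.

Lemma jacobian_comp m n q (f : 'rV[R]_m -> 'rV[R]_n)
    (g : 'rV[R]_n -> 'rV[R]_q) p :
  differentiable f p -> differentiable g (f p) ->
  'J (g \o f) p = 'J f p *m 'J g (f p).
Proof.
move=> df dg; have dgf := differentiable_comp df dg.
apply/row_matrixP => i; rewrite row_mul !rowE.
rewrite -(deriveEjacobian _ dgf) -(deriveEjacobian _ df) -(deriveEjacobian _ dg).
rewrite (deriveE _ dgf) (deriveE _ dg) (deriveE _ df) (diff_comp df dg).
exact: erefl.
Qed.

Lemma jacobian_id n (p : 'rV[R]_n) : 'J (@id 'rV[R]_n) p = 1%:M.
Proof.
have did : differentiable (@id 'rV[R]_n) p by exact: ex_diff.
apply/row_matrixP => i; rewrite !rowE mulmx1 -(deriveEjacobian _ did).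
exact: derive_id.
Qed.

Lemma row_jacobian m n (f : 'rV[R]_m -> 'rV[R]_n) p i :
  differentiable f p -> row i ('J f p) = 'D_(delta_mx 0 i) f p.
Proof. by move=> df; rewrite rowE -(deriveEjacobian _ df). Qed.

Lemma near_eq_jacobian m n (f g : 'rV[R]_m -> 'rV[R]_n) p :
  {near p, f =1 g} -> differentiable f p -> 'J f p = 'J g p.
Proof.
move=> fg df; have dg := near_eq_differentiable fg df.
apply/row_matrixP => i.
have Df := row_jacobian i df; have Dg := row_jacobian i dg.
have DD := near_eq_derive (delta_mx 0 i) fg.
exact (etrans Df (etrans DD (esym Dg))).
Qed.

Lemma jacobian_linear m n (L : {linear 'rV[R]_m -> 'rV[R]_n}) p :
  'J L p = lin1_mx L.
Proof.
have cL := @linear_rV_continuous R m _ L.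
by rewrite /jacobian diff_lin.
Qed.

End jacobian.

(** * Smooth functions vanishing to infinite order at 0 *)

Section flat.
Context {R : realType}.
Implicit Types (x : R) (k : nat).

(* The family is closed under differentiation, up to linear combinations; this
   is what makes the classical flat function [flat 0] smooth. *)
Definition flat k x : R := if 0 < x then x^-1 ^+ k * expR (- x^-1) else 0.

Lemma flat_le0 k x : x <= 0 -> flat k x = 0.
Proof. by rewrite /flat ltNge => ->. Qed.

Lemma flat_gt0 k x : 0 < x -> 0 < flat k x.
Proof.
by move=> x0; rewrite /flat x0 mulr_gt0 ?expR_gt0 ?exprn_gt0 ?invr_gt0.
Qed.

Lemma flat_ge0 k x : 0 <= flat k x.
Proof. by have [/(flat_gt0 k)/ltW|/(flat_le0 k)->] := ltP 0 x. Qed.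

(** The exponential of [x^-1] dominates the term of degree [k + 2] in its series. The square makes
    the difference quotients at 0 tend to 0. *)
Lemma flat_le_sqr k x : flat k x <= k.+2`!%:R * x ^+ 2.
Proof.
have [x0|/(flat_le0 k)->] := ltP 0 x; last by rewrite mulr_ge0 ?sqr_ge0.
have t0 : 0 < x^-1 by rewrite invr_gt0.
rewrite /flat x0 expRN ler_pdivrMr ?expR_gt0 //.
have F0 : (0 : R) < k.+2`!%:R by rewrite ltr0n fact_gt0.
have -> : x^-1 ^+ k = k.+2`!%:R * x ^+ 2 * (x^-1 ^+ k.+2 / k.+2`!%:R).
  rewrite -addn2 exprD; field.
  by rewrite addn2 !gt_eqF.
rewrite ler_pM2l; last by rewrite mulr_gt0 ?exprn_gt0.
have := expR_ge1Dxn k.+1 (ltW t0); apply: le_trans.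
by rewrite lerDr.
Qed.

Lemma is_derive_flat k x :
  is_derive x (1 : R) (flat k) (flat k.+2 x - k%:R * flat k.+1 x).
Proof.
have [x0|x0|<-] := ltgtP 0 x.
- have xN0 : x != 0 by rewrite gt_eqF.
  pose f (y : R) := y^-1 ^+ k * expR (- y^-1).
  apply: (@near_eq_is_derive _ _ _ f).
  + near=> y; rewrite /flat ifT //; near: y; exact: lt_nbhsr.
  + have dV := is_deriveV xN0 (is_derive_id x (1 : R)).
    have dX := is_deriveX k dV.
    have dE := @is_derive1_comp R expR (fun y => - y^-1) x _ _
      (is_derive_expR (- x^-1)) (is_deriveN dV).
    have -> : f = (fun y => y^-1) ^+ k * (expR \o (fun y => - y^-1)).
      by apply/funext => y; rewrite /f fctE exprfctE.
    apply: is_derive_eq (is_deriveM dX dE) _.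
    rewrite /flat x0 exprfctE /GRing.scale /=.
    (* The power rule lowers the exponent by one, so [k = 0] is treated apart. *)
    case: k {f dX} => [/=|k]; first by field.
    by rewrite -[in LHS]natr1 !exprS /=; field.
- rewrite !flat_le0 ?ltW // mulr0 subr0.
  apply: (@near_eq_is_derive _ _ _ (cst 0)).
  by near=> y; rewrite flat_le0 // ltW //; near: y; exact: lt_nbhsl.
(* At 0, [flat_le_sqr] bounds the difference quotient by a multiple of the absolute value of [h],
   which squeezes it to 0. *)
- rewrite !flat_le0 // mulr0 subr0.
  have cvg0 : (fun h : R => h^-1 *: ((flat k \o shift 0) (h *: 1) - flat k 0)) @
      0^' --> (0 : R).
    have F0 : (fun h : R => k.+2`!%:R * `|h|) @ 0^' --> (0 : R).
      have : {for (0 : R), continuous (fun h : R => k.+2`!%:R * `|h|)}.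
        apply: continuousM; [exact: cst_continuous|exact: norm_continuous].
      rewrite /prop_for /continuous_at normr0 mulr0; exact: cvg_within_filter.
    apply: (@squeeze_cvgr _ _ _ _ (fun h => - (k.+2`!%:R * `|h|)) _ _ _ _ _ F0);
      last first.
      have FN := cvgN F0; rewrite oppr0 in FN; exact: FN.
    near=> h; have h0 : h != 0 by near: h; exact: nbhs_dnbhs_neq.
    rewrite -ler_norml /= addr0 [_ *: 1]mulr1 (flat_le0 k (lexx 0)) subr0.
    rewrite normrZ normfV.
    rewrite ler_pdivrMl ?normr_gt0 // (ger0_norm (flat_ge0 _ _)).
    rewrite mulrCA -expr2 real_normK ?num_real //; exact: flat_le_sqr.
  apply: DeriveDef; first by apply/cvg_ex; exists 0.
  exact: cvg_lim cvg0.
Unshelve. all: by end_near. Qed.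

(** The index [j] varies in the induction on [k], since differentiation produces the indices [j.+1]
    and [j.+2]. *)
Lemma Ck_on_flat n k j (U : set 'rV[R]_n) (q : 'rV[R]_n -> R) : open U ->
  Ck_on k U q -> Ck_on k U (flat j \o q).
Proof.
move=> oU; elim: k j => [|k IH] j Uq.
  move=> p Up; apply: continuous_comp; first exact: Uq.
  apply/differentiable_continuous/derivable1_diffP.
  exact: (@ex_derive _ _ _ _ _ _ _ (is_derive_flat j (q p))).
have [dq Dq] := Uq.
have dflat x : differentiable (flat j) x.
  exact/derivable1_diffP/(@ex_derive _ _ _ _ _ _ _ (is_derive_flat j x)).
split=> [p Up|v]; first by apply: differentiable_comp; [exact: dq|].
pose a := flat j.+2 \o q : 'rV[R]_n -> R.
pose b := flat j.+1 \o q : 'rV[R]_n -> R.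
pose dqv := (fun p => 'D_v q p) : 'rV[R]_n -> R.
apply: (@Ck_on_eq _ _ _ _ _ (dqv * (a + cst (- j%:R) * b))) => //; last first.
  have Wq := Ck_onW Uq.
  apply: Ck_onM => //; first exact: Dq.
  apply: Ck_onD => //; first exact: IH.
  by apply: Ck_onM => //; [exact: Ck_on_cst|exact: IH].
move=> p Up; have dqp := dq _ Up.
have dc : differentiable (flat j \o q) p by exact: differentiable_comp.
rewrite (deriveE _ dc) (diff_comp dqp (dflat _)) /= -(deriveE _ dqp).
rewrite -[X in 'd _ _ X]mulr1 linearZ -(deriveE _ (dflat _)).
rewrite (@derive_val _ _ _ _ _ _ _ (is_derive_flat j (q p))).
by rewrite /a /b /dqv !fctE /= mulNr.
Qed.

End flat.

(** * Charts and orientation *)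

Section charts.
Context {R : realType} {n : nat} {M : topologicalType}.
Implicit Types c d e : chart R n M.

Lemma chartK c x : chart_dom c x -> chart_inv c (c x) = x.
Proof. by move=> cx; exact/chart_funK/mem_set. Qed.

Lemma chart_image_open c (A : set M) : open A -> open (c @` (chart_dom c `&` A)).
Proof.
move=> oA; rewrite openE => _ [x [cx Ax] <-].
have cimg : (c @` chart_dom c) (c x) by exists x.
have inv_cont := chart_inv_continuous cimg.
have near_img := open_nbhs_nbhs (conj (@chart_img_open _ _ _ c) cimg).
have near_A : nbhs (c x) (chart_inv c @^-1` A).
  by apply: inv_cont; rewrite chartK //; exact: open_nbhs_nbhs.
apply: filterS2 near_img near_A => _ [y cy <-] /=.
by rewrite chartK // => Ay; exists y.
Qed.

Lemma overlap_open c d : open (c @` (chart_dom c `&` chart_dom d)).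
Proof. by apply: chart_image_open; exact: chart_dom_open. Qed.

Lemma transitionE c d x : chart_dom c x -> transition c d (c x) = d x.
Proof. by move=> cx; rewrite /transition /= chartK. Qed.

Lemma smooth_transition_differentiable c d x :
  smooth_transition c d -> chart_dom c x -> chart_dom d x ->
  differentiable (transition c d) (c x).
Proof. by move=> /(_ 1)[df _] cx dx; apply: df; exists x. Qed.

End charts.

Lemma smooth_chart_atlas (R : realType) (n : nat) (M : smoothManifold R n)
  (c : chart R n M) : atlas c -> smooth_chart c.
Proof. by move=> ac d ad; split; exact: atlas_compatible. Qed.

Section smooth_charts.
Context {R : realType} {n : nat} {M : smoothManifold R n}.
Implicit Types c d e : chart R n M.

(** Near each point the transition factors through a chart [e] of the atlas, with which both [c] and
    [d] are compatible. *)
Lemma smooth_chart_transition c d :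
  smooth_chart c -> smooth_chart d -> smooth_transition c d.
Proof.
move=> sc sd k; apply: Ck_on_pointwise => _ [x [cx dx] <-].
have [e ae ex] := atlas_cover x.
pose U := c @` (chart_dom c `&` (chart_dom d `&` chart_dom e)).
have oU : open U.
  by apply: chart_image_open; apply: openI; exact: chart_dom_open.
apply: (@Ck_on_sub _ _ _ _ U); first by move=> _ ->; exists x.
apply: (@Ck_on_eq _ _ _ _ _ (transition e d \o transition c e)) => //.
  by move=> _ [y [cy [dy ey]] <-]; rewrite /= !transitionE.
apply: (@Ck_on_comp _ _ _ _ _ _ (e @` (chart_dom e `&` chart_dom d))) => //.
- exact: overlap_open.
- by move=> _ [y [cy [dy ey]] <-]; exists y => //; rewrite transitionE.
- apply: Ck_on_sub ((sc e ae).1 k) => _ [y [cy [dy ey]] <-]; by exists y.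
- exact: (sd e ae).2.
Qed.

(** The cocycle identity, obtained from the chain rule because the transitions compose near
    [c x]. *)
Lemma det_transition_trans c d e x :
  smooth_chart c -> smooth_chart d -> smooth_chart e ->
  chart_dom c x -> chart_dom d x -> chart_dom e x ->
  \det ('J (transition c e) (c x)) =
    \det ('J (transition c d) (c x)) * \det ('J (transition d e) (d x)).
Proof.
move=> sc sd se cx dx ex.
have dcd := smooth_transition_differentiable
  (smooth_chart_transition sc sd) cx dx.
have dde := smooth_transition_differentiable
  (smooth_chart_transition sd se) dx ex.
rewrite -(transitionE d cx) in dde *.
have near_comp : {near c x, transition d e \o transition c d =1 transition c e}.
  have : nbhs (c x) (c @` (chart_dom c `&` chart_dom d)).
    by apply: open_nbhs_nbhs; split; [exact: overlap_open|exists x].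
  by apply: filterS => _ [y [cy dy] <-]; rewrite /= !transitionE.
have Jcomp := near_eq_jacobian near_comp (differentiable_comp dcd dde).
rewrite -Jcomp (jacobian_comp dcd dde); exact (det_mulmx _ _).
Qed.

Lemma det_transition_id c x : smooth_chart c -> chart_dom c x ->
  \det ('J (transition c c) (c x)) = 1.
Proof.
move=> sc cx.
have dcc := smooth_transition_differentiable
  (smooth_chart_transition sc sc) cx cx.
have near_id : {near c x, transition c c =1 id}.
  have : nbhs (c x) (c @` chart_dom c).
    by apply: open_nbhs_nbhs; split; [exact: chart_img_open|exists x].
  by apply: filterS => _ [y cy <-]; rewrite transitionE.
by rewrite (near_eq_jacobian near_id dcc) jacobian_id det1.
Qed.

Lemma det_transition_neq0 c d x : smooth_chart c -> smooth_chart d ->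
  chart_dom c x -> chart_dom d x -> \det ('J (transition c d) (c x)) != 0.
Proof.
move=> sc sd cx dx; have := det_transition_trans sc sd sc cx dx cx.
move=> /(etrans (esym (det_transition_id sc cx))) det_mul1.
have unit_neq0 (a b : R) : 1 = a * b -> a != 0.
  by move=> ab; apply/eqP => a0; move/eqP: ab; rewrite a0 mul0r oner_eq0.
exact (unit_neq0 _ _ det_mul1).
Qed.

Lemma near_det_transition_gt0 c d x : smooth_chart c -> smooth_chart d ->
  chart_dom c x -> chart_dom d x -> 0 < \det ('J (transition c d) (c x)) ->
  \forall y \near x, 0 < \det ('J (transition c d) (c y)).
Proof.
move=> sc sd cx dx det0.
have cdet : {for c x, continuous (fun q => \det ('J (transition c d) q))}.
  apply: (continuous_det_jacobian (U := c @` (chart_dom c `&` chart_dom d))).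
  - exact: overlap_open.
  - exact: smooth_chart_transition.
  - by exists x.
have /(_ _ (lt_nbhsr det0)) := continuous_comp (chart_fun_continuous cx) cdet.
exact.
Qed.

(** Turns the cocycle identity of determinants into a comparison of signs relative to a third
    chart. *)
Lemma eq_gt0_factor (a b c : R) : c = a * b -> a != 0 -> b != 0 ->
  ((0 < c) == (0 < b)) = (0 < a).
Proof.
move=> -> a0 b0; have [a_gt0|a_lt0|/esym/eqP] := ltgtP 0 a.
- by rewrite pmulr_rgt0 ?eqxx.
- by rewrite nmulr_rgt0 //; case: (ltgtP 0 b) b0 => // <-; rewrite eqxx.
- by rewrite (negbTE a0).
Qed.

(* The sign at [x] compares the chart with an arbitrary reference chart chosen
   at [x], so it is not continuous in [x]: only comparisons between two charts
   are meaningful. *)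
Lemma orientation_sign_exists : exists s : chart R n M -> M -> bool,
  forall c d x, smooth_chart c -> smooth_chart d ->
    chart_dom c x -> chart_dom d x ->
    (s c x == s d x) = (0 < \det ('J (transition c d) (c x))).
Proof.
pose r x : chart R n M := s2val (cid2 (atlas_cover x)).
exists (fun c x => 0 < \det ('J (transition c (r x)) (c x))).
move=> c d x sc sd cx dx.
have sr : smooth_chart (r x).
  exact/smooth_chart_atlas/(s2valP (cid2 (atlas_cover x))).
have rx : chart_dom (r x) x by exact: (s2valP' (cid2 (atlas_cover x))).
exact (eq_gt0_factor (det_transition_trans sc sd sr cx dx rx)
  (det_transition_neq0 sc sd cx dx) (det_transition_neq0 sd sr dx rx)).
Qed.

Definition chart_or : chart R n M -> M -> bool :=
  sval (cid orientation_sign_exists).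

Lemma chart_or_eq c d x : smooth_chart c -> smooth_chart d ->
  chart_dom c x -> chart_dom d x ->
  (chart_or c x == chart_or d x) = (0 < \det ('J (transition c d) (c x))).
Proof. exact: (svalP (cid orientation_sign_exists)). Qed.

(** By [chart_or_eq], agreement of orientations is positivity of a continuous determinant. This is
    what makes the lifted chart domains open. *)
Lemma chart_or_eq_open c d : smooth_chart c -> smooth_chart d ->
  open [set x | [/\ chart_dom c x, chart_dom d x & chart_or c x = chart_or d x]].
Proof.
move=> sc sd; rewrite openE => x [cx dx /eqP].
rewrite chart_or_eq // => /(near_det_transition_gt0 sc sd cx dx).
have nc := open_nbhs_nbhs (conj (@chart_dom_open _ _ _ c) cx).
have nd := open_nbhs_nbhs (conj (@chart_dom_open _ _ _ d) dx).
apply: filterS3 nc nd => y cy dy det0.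
by split=> //; apply/eqP; rewrite chart_or_eq.
Qed.

End smooth_charts.

(** * Reflected charts, which induce the opposite orientation *)

Section reflection.
Context {R : realType} {n : nat} {M : smoothManifold R n} (i0 : 'I_n).
Implicit Types c d e : chart R n M.

Definition reflmx : 'M[R]_n := diag_mx (\row_j (-1) ^+ (j == i0)).

Lemma reflmxK : reflmx *m reflmx = 1%:M.
Proof.
rewrite mulmx_diag -diag_const_mx; congr diag_mx; apply/rowP => j.
by rewrite !mxE -expr2 sqrr_sign.
Qed.

Lemma det_reflmx : \det reflmx = -1.
Proof.
rewrite det_diag (bigD1 i0) //= mxE eqxx big1 ?mulr1 // => j /negbTE ji.
by rewrite mxE ji.
Qed.

Definition refl : 'rV[R]_n -> 'rV[R]_n := mulmxr reflmx.

Lemma reflK : involutive refl.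
Proof. by move=> v; rewrite /refl /= -mulmxA reflmxK mulmx1. Qed.

Lemma refl_continuous : continuous refl.
Proof. exact: linear_rV_continuous. Qed.

Lemma refl_Ck k (U : set 'rV[R]_n) : open U -> Ck_on k U refl.
Proof.
move=> oU; exact: (Ck_on_linear_rV (mulmxr reflmx) oU (Ck_on_id k oU)).
Qed.

Lemma refl_image c : (refl \o c) @` chart_dom c = refl @^-1` (c @` chart_dom c).
Proof.
apply/seteqP; split=> [_ [x cx <-]|p [x cx cxE]] /=.
  by rewrite reflK; exists x.
by exists x => //=; rewrite cxE reflK.
Qed.

Lemma refl_img_open c : open ((refl \o c) @` chart_dom c).
Proof.
rewrite refl_image; apply: open_comp; last exact: chart_img_open.
by move=> p _; exact: refl_continuous.
Qed.

Lemma refl_funK c : {in chart_dom c, cancel (refl \o c) (chart_inv c \o refl)}.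
Proof. by move=> x cx; rewrite /= reflK chart_funK. Qed.

Lemma refl_fun_continuous c x : chart_dom c x -> {for x, continuous (refl \o c)}.
Proof.
by move=> cx; apply: continuous_comp;
  [exact: chart_fun_continuous|exact: refl_continuous].
Qed.

Lemma refl_inv_continuous c p : ((refl \o c) @` chart_dom c) p ->
  {for p, continuous (chart_inv c \o refl)}.
Proof.
rewrite refl_image => cp; apply: continuous_comp; first exact: refl_continuous.
exact: chart_inv_continuous.
Qed.

Definition refl_chart c : chart R n M :=
  Chart (@chart_dom_open _ _ _ c) (@refl_img_open c) (@refl_funK c)
    (@refl_fun_continuous c) (@refl_inv_continuous c).

Lemma refl_chart_smooth c : smooth_chart c -> smooth_chart (refl_chart c).
Proof.
move=> sc d ad; have [cd dc] := sc d ad; split=> k.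
- apply: (@Ck_on_comp _ _ _ _ _ _ (c @` (chart_dom c `&` chart_dom d)) refl
    (transition c d)) => //; [exact: overlap_open|exact: overlap_open| |].
  + by move=> _ [x cdx <-]; exists x => //=; rewrite reflK.
  + by apply: refl_Ck; exact: overlap_open.
- have oU : open (d @` (chart_dom d `&` chart_dom c)) by exact: overlap_open.
  have := Ck_on_linear_rV (mulmxr reflmx) oU (dc k).
  exact.
Qed.

(** The transition from the reflected chart to [c] is the reflection itself, whose determinant is
    -1. *)
Lemma chart_or_refl c x : smooth_chart c -> chart_dom c x ->
  chart_or (refl_chart c) x = ~~ chart_or c x.
Proof.
move=> sc cx; have src := refl_chart_smooth sc.
have drc := smooth_transition_differentiable
  (smooth_chart_transition src sc) cx cx.
have near_refl :
    {near refl_chart c x, transition (refl_chart c) c =1 mulmxr reflmx}.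
  have : nbhs (refl_chart c x) (refl_chart c @` chart_dom c).
    by apply: open_nbhs_nbhs; split; [exact: refl_img_open|exists x].
  apply: filterS => _ [y cy <-].
  by rewrite transitionE //= -[RHS]/(refl (refl (c y))) reflK.
have Jrefl : 'J (transition (refl_chart c) c) (refl_chart c x) = reflmx.
  apply: etrans (near_eq_jacobian near_refl drc) _.
  apply: etrans (jacobian_linear (mulmxr reflmx) (refl_chart c x)) _.
  by apply/row_matrixP => i; rewrite rowE mul_rV_lin1 /= -rowE.
have := @chart_or_eq _ _ _ (refl_chart c) c x src sc cx cx.
rewrite Jrefl det_reflmx oppr_gt0 ltNge ler01 /=.
by case: (chart_or _ x); case: (chart_or c x).
Qed.

(** The bit [s] serves to adjust a chart to a prescribed orientation at a given point. *)
Definition flip_chart (s : bool) c := if s then refl_chart c else c.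

Lemma flip_chart_smooth s c : smooth_chart c -> smooth_chart (flip_chart s c).
Proof. by case: s => //; exact: refl_chart_smooth. Qed.

Lemma flip_chart_dom s c : chart_dom (flip_chart s c) = chart_dom c.
Proof. by case: s. Qed.

Lemma chart_or_flip s c x : smooth_chart c -> chart_dom c x ->
  chart_or (flip_chart s c) x = s (+) chart_or c x.
Proof. by case: s => //; exact: chart_or_refl. Qed.

End reflection.

(** * Bump functions *)

(** [bump_supp] may be larger than the actual support. Being closed and inside the chart domain, it
    allows expressions that make sense only in that chart to be multiplied by the bump and extended
    by zero. *)
Record bump (R : realType) (n : nat) (M : smoothManifold R n) := Bump {
  bump_chart : chart R n M;
  bump_fun :> M -> R;
  bump_supp : set M;
  bump_chart_atlas : atlas bump_chart;
  bump_supp_closed : closed bump_supp;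
  bump_supp_dom : bump_supp `<=` chart_dom bump_chart;
  bump_fun_ge0 : forall x, 0 <= bump_fun x;
  bump_fun_out : forall x, ~ bump_supp x -> bump_fun x = 0;
  bump_fun_smooth :
    smooth_on (bump_chart @` chart_dom bump_chart)
      (bump_fun \o chart_inv bump_chart)
}.

Section bumps.
Context {R : realType} {n : nat}.

Definition cube (p : 'rV[R]_n) (r : R) : set 'rV[R]_n :=
  [set v | forall j, v ord0 j \in `[p ord0 j - r, p ord0 j + r]].

Lemma cube_compact p r : compact (cube p r).
Proof.
by apply: (@rV_compact _ _ (fun j => [set` `[p ord0 j - r, p ord0 j + r]])) => j;
  exact: segment_compact.
Qed.

Lemma cube_sub_ball p r e : 0 < e -> r < e -> cube p r `<=` ball p e.
Proof.
move=> e0 re v pv; split=> // i j; rewrite ord1 -ball_normE /= distrC.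
by apply: le_lt_trans re; rewrite ler_distl; have := pv j; rewrite in_itv.
Qed.

(** The Euclidean distance is used instead of the sup norm because its square is a polynomial; the
    Euclidean ball where this is positive lies in the cube. *)
Definition cube_fun (p : 'rV[R]_n) (r : R) : 'rV[R]_n -> R :=
  fun v => r ^+ 2 - \sum_j (v ord0 j - p ord0 j) ^+ 2.

Lemma cube_fun_Ck p r k (U : set 'rV[R]_n) : open U -> Ck_on k U (cube_fun p r).
Proof.
move=> oU.
pose f j : 'rV[R]_n -> R :=
    (fun v : 'rV[R]_n => v ord0 j) + cst (- p ord0 j).
have -> : cube_fun p r = cst (r ^+ 2) + cst (- 1) * \sum_j (f j * f j).
  apply/funext => v; rewrite /cube_fun !fctE fct_sumE mulN1r; congr (_ - _).
have fC j : Ck_on k U (f j).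
  apply: Ck_onD => //; last exact: Ck_on_cst.
  exact (Ck_on_coord j oU (Ck_on_id k oU)).
apply: Ck_onD => //; first exact: Ck_on_cst.
apply: Ck_onM => //; first exact: Ck_on_cst.
by apply: Ck_on_sum => // j _; exact: Ck_onM.
Qed.

Lemma cube_fun_center p r : cube_fun p r p = r ^+ 2.
Proof.
by rewrite /cube_fun big1 ?subr0 // => j _; rewrite subrr expr0n.
Qed.

Lemma cube_fun_gt0 p r v : 0 < r -> 0 < cube_fun p r v -> cube p r v.
Proof.
move=> r0; rewrite /cube_fun subr_gt0 => sum_lt j.
rewrite in_itv /= -ler_distl -ler_sqr ?nnegrE ?normr_ge0 ?(ltW r0) //.
rewrite real_normK ?num_real //.
apply: le_trans (ltW sum_lt).
rewrite (bigD1 j) //= lerDl; apply: sumr_ge0 => i _; exact: sqr_ge0.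
Qed.

Context {M : smoothManifold R n}.

Lemma bump_near (x0 : M) : exists b : bump M, \forall y \near x0, 0 < b y.
Proof.
have [c ac cx0] := atlas_cover x0.
have cimg : (c @` chart_dom c) (c x0) by exists x0.
have /nbhs_ballP[e /= e0 ball_img] :=
  open_nbhs_nbhs (conj (@chart_img_open _ _ _ c) cimg).
(* Any positive radius below [e] would do: the closed cube has to stay inside the ball. *)
pose r := e / 2; have r0 : 0 < r by rewrite divr_gt0.
have re : r < e by rewrite /r ltr_pdivrMr // ltr_pMr // ltr1n.
have cube_img : cube (c x0) r `<=` c @` chart_dom c.
  exact: subset_trans (cube_sub_ball e0 re) ball_img.
pose q := cube_fun (c x0) r.
pose f y : R := if pselect (chart_dom c y) then flat 0 (q (c y)) else 0.
have fE y : chart_dom c y -> f y = flat 0 (q (c y)).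
  by rewrite /f; case: pselect.
(* [K] is compact as the continuous image of a cube, hence closed in the Hausdorff space [M]. *)
pose K := chart_inv c @` cube (c x0) r.
have Kcl : closed K.
  apply: compact_closed; first exact: manifold_hausdorff.
  apply: continuous_compact; last exact: cube_compact.
  apply: continuous_in_subspaceT => p /set_mem pc.
  exact/chart_inv_continuous/cube_img.
have Kdom : K `<=` chart_dom c.
  by move=> _ [p /cube_img[y cy <-] <-]; rewrite chartK.
have f0 y : 0 <= f y by rewrite /f; case: pselect => // cy; exact: flat_ge0.
have fout y : ~ K y -> f y = 0.
  move=> nKy; rewrite /f; case: pselect => // cy; apply: flat_le0.
  rewrite leNgt; apply/negP => qpos; apply: nKy.
  by exists (c y); [exact: cube_fun_gt0 qpos|exact: chartK].
have oimg := @chart_img_open _ _ _ c.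
have fsm : smooth_on (c @` chart_dom c) (f \o chart_inv c).
  move=> k; apply: (@Ck_on_eq _ _ _ _ _ (flat 0 \o q)) => //; last first.
    by apply: Ck_on_flat => //; exact: cube_fun_Ck.
  by move=> _ [y cy <-]; rewrite /= chartK // fE.
exists (Bump ac Kcl Kdom f0 fout fsm) => /=.
have near_dom := open_nbhs_nbhs (conj (@chart_dom_open _ _ _ c) cx0).
have qc : {for c x0, continuous q}.
  apply: (@Ck_on_continuous _ _ _ 0 setT) => //.
  by apply: cube_fun_Ck; exact: openT.
have q0 : 0 < q (c x0) by rewrite /q cube_fun_center exprn_gt0.
have near_q : \forall y \near x0, 0 < q (c y).
  exact: (continuous_comp (chart_fun_continuous cx0) qc) (lt_nbhsr q0).
by apply: filterS2 near_dom near_q => y cy qy; rewrite fE // flat_gt0.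
Qed.

Lemma finite_bumps : compact [set: M] -> exists (N : nat) (b : 'I_N -> bump M),
  forall x, exists i, 0 < b i x.
Proof.
move=> cM; have [B Bnear] := choice bump_near.
(* The filter of eventual properties of finite lists ordered by inclusion. Compactness in its
   near-covering form then yields one list of centres that serves all points at once. *)
pose F : set_system (seq M) :=
  [set A | exists s0 : seq M, forall s : seq M, {subset s0 <= s} -> A s].
have FF : Filter F.
  split; first by exists [::].
    move=> P Q [s1 P1] [s2 Q2]; exists (s1 ++ s2) => s s12; split.
      by apply: P1 => x x1; apply: s12; rewrite mem_cat x1.
    by apply: Q2 => x x2; apply: s12; rewrite mem_cat x2 orbT.
  by move=> P Q PQ [s0 P0]; exists s0 => s /P0/PQ.
pose P (s : seq M) y := exists2 x, x \in s & 0 < B x y.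
have [x _|s0 /(_ s0 (fun=> id)) s0P] := (compact_near_coveringP _).1 cM _ F P FF.
  exists ([set y | 0 < B x y], [set s : seq M | x \in s]) => /=.
    by split; [exact: Bnear|exists [:: x] => s; apply; rewrite inE].
  by move=> [y s] /= [Bxy xs]; exists x.
exists (size s0), (fun i => B (tnth (in_tuple s0) i)) => x.
have [y ys Byx] := s0P x I.
have ys' : (index y s0 < size s0)%N by rewrite index_mem.
by exists (Ordinal ys'); rewrite (tnth_nth y) /= nth_index.
Qed.

End bumps.

(** * The orientation cover *)

(* [(x, o)] is the orientation at [x] induced by the charts [c] such that
   [chart_or c x = o]. The topology is the final one for the sections [sheet c],
   not the product topology. *)
Definition orcover (R : realType) (n : nat) (M : smoothManifold R n) : Type :=
  (M * bool)%type.

HB.instance Definition _ (R : realType) (n : nat) (M : smoothManifold R n) :=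
  Choice.copy (orcover M) (M * bool)%type.

Section orcover_topology.
Context {R : realType} {n : nat} {M : smoothManifold R n}.
Implicit Types (c d : chart R n M) (O : set (orcover M)).

Definition sheet c (x : M) : orcover M := (x, chart_or c x).

Definition orcover_open O : Prop := forall c, smooth_chart c ->
  open [set x | chart_dom c x /\ O (sheet c x)].

Let orcover_openT : orcover_open setT.
Proof.
move=> c _; have -> : [set x | chart_dom c x /\ setT (sheet c x)] = chart_dom c.
  by apply/seteqP; split=> x // [].
exact: chart_dom_open.
Qed.

Let orcover_openI O1 O2 :
  orcover_open O1 -> orcover_open O2 -> orcover_open (O1 `&` O2).
Proof.
move=> o1 o2 c sc; have := openI (o1 c sc) (o2 c sc); congr open.
by apply/seteqP; split=> [x [[? ?] [? ?]]|x [? [? ?]]].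
Qed.

Let orcover_open_bigU (I : Type) (f : I -> set (orcover M)) :
  (forall i, orcover_open (f i)) -> orcover_open (\bigcup_i f i).
Proof.
move=> of_ c sc.
have : open (\bigcup_i [set x | chart_dom c x /\ f i (sheet c x)]).
  by apply: bigcup_open => i _; exact: of_.
congr open; apply/seteqP; split=> [x [i _ [cx fx]]|x [cx [i _ fx]]].
  by split=> //; exists i.
by exists i.
Qed.

HB.instance Definition _ := isOpenTopological.Build (orcover M)
  orcover_openT orcover_openI orcover_open_bigU.

Lemma orcover_openE O : open O = orcover_open O.
Proof. by []. Qed.

Definition lift_dom c : set (orcover M) :=
  [set y | chart_dom c y.1 /\ y.2 = chart_or c y.1].

Definition cover_proj : orcover M -> M := fst.

Lemma sheet_continuous c x : smooth_chart c -> chart_dom c x ->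
  {for x, continuous (sheet c)}.
Proof.
move=> sc cx A; rewrite nbhsE => -[Q [oQ Qx] QA].
have /(_ _ sc) oU : orcover_open Q by rewrite -orcover_openE.
by apply: filterS (open_nbhs_nbhs (conj oU (conj cx Qx))) => y [_ /QA].
Qed.

Lemma cover_proj_continuous : continuous cover_proj.
Proof.
apply/continuousP => U oU; rewrite orcover_openE => c _.
exact: openI (@chart_dom_open _ _ _ c) oU.
Qed.

(** Seen through the section [sheet d], this domain is the set where [c] and [d] induce the same
    orientation. *)
Lemma lift_dom_open c : smooth_chart c -> open (lift_dom c).
Proof.
move=> sc; rewrite orcover_openE => d sd.
have := chart_or_eq_open sd sc; congr open.
by apply/seteqP; split=> [x [? ? ?]|x [? [? ?]]].
Qed.

Lemma lift_dom_sheet c y : lift_dom c y -> sheet c y.1 = y.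
Proof. by case: y => x o [/= _ ->]. Qed.

Lemma lift_image c : (c \o cover_proj) @` lift_dom c = c @` chart_dom c.
Proof.
apply/seteqP; split=> [_ [y [cy _] <-]|_ [x cx <-]]; first by exists y.1.
by exists (sheet c x).
Qed.

Section lift.
Context (c : chart R n M) (sc : smooth_chart c).

Let lift_img_open : open ((c \o cover_proj) @` lift_dom c).
Proof. by rewrite lift_image; exact: chart_img_open. Qed.

Let lift_funK :
  {in lift_dom c, cancel (c \o cover_proj) (sheet c \o chart_inv c)}.
Proof.
by move=> y /set_mem cy; rewrite /= chartK ?lift_dom_sheet //; case: cy.
Qed.

Let lift_fun_continuous y : lift_dom c y ->
  {for y, continuous (c \o cover_proj)}.
Proof.
move=> [cy _]; apply: continuous_comp; first exact: cover_proj_continuous.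
exact: chart_fun_continuous.
Qed.

Let lift_inv_continuous p : ((c \o cover_proj) @` lift_dom c) p ->
  {for p, continuous (sheet c \o chart_inv c)}.
Proof.
rewrite lift_image => cp.
apply: continuous_comp; first exact: chart_inv_continuous.
by apply: sheet_continuous => //; case: cp => x cx <-; rewrite chartK.
Qed.

Definition lift_chart : chart R n (orcover M) :=
  Chart (lift_dom_open sc) lift_img_open lift_funK lift_fun_continuous
    lift_inv_continuous.

End lift.

Definition lift_atlas : set (chart R n (orcover M)) :=
  [set C | exists c (sc : smooth_chart c), C = lift_chart sc].

(** The transition between two lifts is the same function as the transition downstairs, on a smaller
    domain. *)
Lemma lift_atlas_compatible C D :
  lift_atlas C -> lift_atlas D -> smooth_transition C D.
Proof.
move=> [c [sc ->]] [d [sd ->]] k.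
apply: Ck_on_sub (smooth_chart_transition sc sd k).
by move=> _ [y [[cy _] [dy _]] <-]; exists y.1.
Qed.

Lemma lift_dom_or c d y : smooth_chart c -> smooth_chart d ->
  lift_dom c y -> lift_dom d y -> 0 < \det ('J (transition c d) (c y.1)).
Proof.
move=> sc sd [cy yc] [dy yd].
by rewrite -(chart_or_eq sc sd cy dy) -yc -yd.
Qed.

Context (i0 : 'I_n).

Definition cover_swap (y : orcover M) : orcover M := (y.1, ~~ y.2).

Lemma cover_swapK : involutive cover_swap.
Proof. by case=> x o; rewrite /cover_swap /= negbK. Qed.

Lemma sheet_refl c x : smooth_chart c -> chart_dom c x ->
  sheet (refl_chart i0 c) x = cover_swap (sheet c x).
Proof. by move=> sc cx; rewrite /sheet /cover_swap /= chart_or_refl. Qed.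

(** The swap carries the sheet of [c] to the sheet of its reflection, and the topology is tested on
    sheets. *)
Lemma cover_swap_continuous : continuous cover_swap.
Proof.
apply/continuousP => O oO; rewrite orcover_openE => c sc.
have := oO _ (refl_chart_smooth i0 sc); congr open.
by apply/seteqP; split=> x /= [cx]; rewrite sheet_refl.
Qed.

(** The bit records whether the orientation [y.2] differs from the one induced by [c], so flipping
    by it corrects [c]. *)
Lemma lift_dom_flip c y : smooth_chart c -> chart_dom c y.1 ->
  lift_dom (flip_chart i0 (y.2 (+) chart_or c y.1) c) y.
Proof.
by move=> sc cy; rewrite /lift_dom /= flip_chart_dom chart_or_flip // addbK.
Qed.

Lemma lift_atlas_cover y : exists2 C, lift_atlas C & chart_dom C y.
Proof.
have [c ac cy] := atlas_cover y.1; have sc := smooth_chart_atlas ac.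
have sf := flip_chart_smooth i0 (y.2 (+) chart_or c y.1) sc.
exists (lift_chart sf); last exact: lift_dom_flip.
by exists (flip_chart i0 (y.2 (+) chart_or c y.1) c), sf.
Qed.

(** Points over distinct base points are separated downstairs; the two points of a fibre are
    separated by the lifts of a chart and of its reflection. *)
Lemma orcover_hausdorff : hausdorff_space (orcover M).
Proof.
rewrite open_hausdorff => y y' yy'.
have [xx'|xx'] := eqVneq y.1 y'.1; last first.
  have := @manifold_hausdorff _ _ M; rewrite open_hausdorff => /(_ _ _ xx').
  move=> [[U V] /= [/set_mem yU /set_mem y'V] [oU oV /eqP UV0]].
  exists (cover_proj @^-1` U, cover_proj @^-1` V) => /=.
    by split; exact/mem_set.
  split; [| |by rewrite -preimage_setI UV0 preimage_set0].
  - by apply: open_comp => // + _; exact: cover_proj_continuous.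
  - by apply: open_comp => // + _; exact: cover_proj_continuous.
have oo' : y'.2 = ~~ y.2.
  case: y y' yy' xx' => x [] [x' []] //= + xx'; by rewrite xx' eqxx.
have [C [c [sc ->]] yc] := lift_atlas_cover y.
have [cy yor] := yc.
exists (lift_dom c, lift_dom (refl_chart i0 c)) => /=.
  split; apply/mem_set => //; split; rewrite /= -xx' //.
  by rewrite chart_or_refl // oo' yor.
split; [exact: lift_dom_open|exact/lift_dom_open/refl_chart_smooth|].
apply/eqP/seteqP; split=> // z [[cz zc] [_]].
by rewrite chart_or_refl // zc; case: chart_or.
Qed.

(** A countable basis of [M], pulled back and cut down to the lifts of the finitely many charts and
    of their reflections, is a basis of the cover. *)
Lemma orcover_second_countable (N : nat) (c : 'I_N -> chart R n M) :
  (forall i, smooth_chart (c i)) -> (forall x, exists i, chart_dom (c i) x) ->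
  second_countable (T := orcover M).
Proof.
move=> sc cover; have [B cB [Bo Bbasis]] := @manifold_second_countable _ _ M.
pose cs (i : 'I_N * bool) := flip_chart i0 i.2 (c i.1).
have scs i : smooth_chart (cs i) by exact: flip_chart_smooth.
pose W (k : set M * ('I_N * bool)) := cover_proj @^-1` k.1 `&` lift_dom (cs k.2).
exists (W @` (B `*` setT)).
  by apply: card_le_trans (card_image_le _ _) _; exact: countableX.
split=> [_ [[U i] /= [BU _] <-]|y A].
  apply: openI; last exact: lift_dom_open.
  by apply: open_comp; [move=> + _; exact: cover_proj_continuous|exact: Bo].
rewrite nbhsE => -[Q [oQ Qy] QA].
have [i ciy] := cover y.1.
pose b := y.2 (+) chart_or (c i) y.1.
have yb : lift_dom (cs (i, b)) y by exact: lift_dom_flip.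
have oV := oQ _ (scs (i, b)).
have [|V [BV Vy] VO] := Bbasis y.1 _ (open_nbhs_nbhs (conj oV _)).
  by split; [case: yb|rewrite lift_dom_sheet].
exists (W (V, (i, b))); first by split; [exists (V, (i, b))|split].
by move=> z [/= /VO[_ Oz] zb]; apply: QA; rewrite -(lift_dom_sheet zb).
Qed.

End orcover_topology.

(** * The odd embedding *)

Section dehomogenization.
Context {R : realType} {n : nat}.

(** Passage from homogeneous to affine coordinates where the first coordinate is nonzero; [homog] is
    the representative with first coordinate 1. *)
Definition dehom (w : 'rV[R]_(1 + n)) : 'rV[R]_n :=
  (w 0 (lshift n 0))^-1 *: rsubmx w.

Definition homog (q : 'rV[R]_n) : 'rV[R]_(1 + n) := row_mx 1%:M q.

Lemma scale_homogE a q : (a *: homog q) 0 (lshift n 0) = a.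
Proof. by rewrite mxE row_mxEl mxE mulr1. Qed.

Lemma dehomK a q : a != 0 -> dehom (a *: homog q) = q.
Proof.
move=> a0; rewrite /dehom scale_homogE linearZ /= row_mxKr scalerA mulVf //.
by rewrite scale1r.
Qed.

Lemma homog_Ck k (U : set 'rV[R]_n) : open U -> Ck_on k U homog.
Proof.
move=> oU; have -> : homog = cst (row_mx 1%:M 0) + mulmxr (row_mx 0 1%:M).
  apply/funext => q.
  transitivity (row_mx 1%:M 0 + q *m row_mx 0 1%:M); last by [].
  by rewrite mul_mx_row mulmx1 mulmx0 add_row_mx addr0 add0r.
apply: Ck_onD => //; first exact: Ck_on_cst.
exact (Ck_on_linear_rV (mulmxr (row_mx 0 1%:M)) oU (Ck_on_id k oU)).
Qed.

Lemma dehom_differentiable (w : 'rV[R]_(1 + n)) :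
  w 0 (lshift n 0) != 0 -> differentiable dehom w.
Proof.
move=> w0; have -> : dehom = \sum_j (fun v : 'rV[R]_(1 + n) =>
    ((v 0 (lshift n 0))^-1 * v 0 (rshift 1 j)) *: delta_mx 0 j).
  apply/funext => v; rewrite fct_sumE [LHS](row_sum_delta (dehom v)).
  by apply: eq_bigr => j _; rewrite /dehom !mxE.
apply: differentiable_sum => j.
apply: (@differentiableZl _ _ _ (fun v : 'rV[R]_(1 + n) =>
  (v 0 (lshift n 0))^-1 * v 0 (rshift 1 j))).
apply: differentiableM; last exact: differentiable_coord.
by apply: differentiableV => //; exact: differentiable_coord.
Qed.

End dehomogenization.

Section odd_coordinates.
Context {R : realType} {n : nat} {M : smoothManifold R n} (i0 : 'I_n).
Context (b : bump M).
Let c := bump_chart b.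
Let sc : smooth_chart c := smooth_chart_atlas (@bump_chart_atlas _ _ _ b).
Implicit Types (x : M) (y : orcover M).

Lemma bump_gt0_dom x : 0 < b x -> chart_dom c x.
Proof.
move=> bx; have [|nKx] := pselect (bump_supp b x); first exact: bump_supp_dom.
by move: bx; rewrite bump_fun_out // ltxx.
Qed.

Lemma bump_gt0_open : open [set x | 0 < b x].
Proof.
rewrite openE => x /= bx; have cx := bump_gt0_dom bx.
have cimg : (c @` chart_dom c) (c x) by exists x.
have bc := Ck_on_continuous (@bump_fun_smooth _ _ _ b 0) cimg.
have b0 : 0 < ((b \o chart_inv c) \o c) x by rewrite /= chartK.
have near_b : \forall y \near x, 0 < ((b \o chart_inv c) \o c) y.
  exact: (continuous_comp (chart_fun_continuous cx) bc (lt_nbhsr b0)).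
have near_c := open_nbhs_nbhs (conj (@chart_dom_open _ _ _ c) cx).
by apply: filterS2 near_c near_b => y cy; rewrite /= chartK.
Qed.

(* Meaningful only over the domain of the chart of [b]; elsewhere [b] vanishes
   and the sign does not matter. *)
Definition odd_sign y : bool := y.2 (+) chart_or c y.1.

Definition odd_coord y : 'rV[R]_(1 + n) :=
  ((-1) ^+ odd_sign y * b y.1) *: homog (c y.1).

Lemma odd_coord_swap y : odd_coord (cover_swap y) = - odd_coord y.
Proof.
rewrite /odd_coord /odd_sign /= -scaleNr -mulNr; congr ((_ * _) *: _).
by case: (y.2) (chart_or c y.1) => -[]; rewrite ?opprK.
Qed.

Lemma odd_coord_head y :
  odd_coord y 0 (lshift n 0) = (-1) ^+ odd_sign y * b y.1.
Proof. exact: scale_homogE. Qed.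

Lemma odd_coord_head_neq0 y : 0 < b y.1 -> odd_coord y 0 (lshift n 0) != 0.
Proof. by move=> by0; rewrite odd_coord_head mulf_neq0 ?signr_eq0 // gt_eqF. Qed.

Lemma dehom_odd_coord y : 0 < b y.1 -> dehom (odd_coord y) = c y.1.
Proof.
by move=> /odd_coord_head_neq0; rewrite odd_coord_head; exact: dehomK.
Qed.

(** The product is a sign times two nonnegative bump values. Its positivity is an open condition on
    the vector of [y'], and it excludes both a vanishing bump and opposite signs. *)
Lemma odd_coord_head_mul_gt0 y y' : 0 < b y.1 ->
  0 < odd_coord y 0 (lshift n 0) * odd_coord y' 0 (lshift n 0) ->
  0 < b y'.1 /\ odd_sign y' = odd_sign y.
Proof.
rewrite !odd_coord_head => by0; rewrite mulrACA -signr_addb.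
have := bump_fun_ge0 b y'.1; rewrite le_eqVlt => /predU1P[<-|by'0].
  by rewrite !mulr0 ltxx.
rewrite pmulr_lgt0 ?mulr_gt0 // => s0; split=> //.
by case: (odd_sign y) (odd_sign y') s0 => -[] //=; rewrite expr1 oppr_gt0 ltr10.
Qed.

Lemma odd_coord_Ck (d : chart R n M) (sd : smooth_chart d) k :
  Ck_on k (d @` chart_dom d) (odd_coord \o chart_inv (lift_chart sd)).
Proof.
apply: Ck_on_pointwise => _ [x dx <-].
(* Off the closed set [bump_supp b] the map is locally zero. *)
have [Kx|nKx] := pselect (bump_supp b x); last first.
  pose V := d @` (chart_dom d `&` ~` bump_supp b).
  have oV : open V.
    by apply: chart_image_open; exact/closed_openC/bump_supp_closed.
  apply: (@Ck_on_sub _ _ _ _ V); first by move=> _ ->; exists x.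
  apply: Ck_on_eq (Ck_on_cst k V 0) => // _ [y [dy nKy] <-].
  by rewrite /= chartK // /odd_coord /= bump_fun_out // mulr0 scale0r.
have cx : chart_dom c x by exact: bump_supp_dom.
(* Flipping [c] by [s] makes it agree with [d] at [x], hence on an open set. There the sign is the
   constant [(-1) ^+ s], and the map is a smooth expression in [c] composed with a transition. *)
pose s := odd_sign (sheet d x); pose c' := flip_chart i0 s c.
have sc' : smooth_chart c' by exact: flip_chart_smooth.
have dc' : chart_dom c' = chart_dom c by exact: flip_chart_dom.
pose U :=
  [set y | [/\ chart_dom d y, chart_dom c' y & chart_or d y = chart_or c' y]].
pose V := d @` (chart_dom d `&` U).
have oV : open V by apply: chart_image_open; exact: chart_or_eq_open.
have oimg : open (c @` chart_dom c) by exact: chart_img_open.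
have xV : V (d x).
  exists x => //; split=> //; split=> //; first by rewrite dc'.
  by rewrite chart_or_flip // /s /odd_sign addbK.
apply: (@Ck_on_sub _ _ _ _ V) => [_ -> //|].
pose G q := b (chart_inv c q) *: homog q.
have G_Ck : Ck_on k (c @` chart_dom c) G.
  by apply: Ck_onZ => //; [exact: bump_fun_smooth|exact: homog_Ck].
have T_Ck : Ck_on k V (transition d c).
  apply: Ck_on_sub (smooth_chart_transition sd sc k).
  by move=> _ [y [dy [_ cy _]] <-]; exists y; rewrite -?dc'.
have VT p : V p -> (c @` chart_dom c) (transition d c p).
  by move=> [y [dy [_ cy _]] <-]; exists y; rewrite -?dc' ?transitionE.
have GT_Ck : Ck_on k V (G \o transition d c) by exact: Ck_on_comp VT T_Ck G_Ck.
have sGT_Ck := Ck_onZ oV (Ck_on_cst k V ((-1) ^+ s : R)) GT_Ck.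
apply: (Ck_on_eq oV _ sGT_Ck).
move=> _ [y [dy [_ cy dc]] <-]; have cy' : chart_dom c y by rewrite -dc'.
rewrite /= /G transitionE // !chartK // scalerA /odd_coord /odd_sign /= dc.
by rewrite chart_or_flip // addbK.
Qed.

End odd_coordinates.

Section embedding.
Context {R : realType} {n : nat} {M : smoothManifold R n} (i0 : 'I_n).
Context {N : nat} (b : 'I_N -> bump M) (b_cover : forall x, exists i, 0 < b i x).
Local Notation p := (N * (1 + n))%N.
Implicit Types (y : orcover M).

(** The vectors [odd_coord (b i) y] are the rows of an [N] by [1 + n] matrix, flattened by [mxvec];
    [block] reads off a row. *)
Definition odd_map y : 'rV[R]_p :=
  \sum_i mxvec (delta_mx i (0 : 'I_1) *m odd_coord (b i) y).

Definition block (i : 'I_N) (u : 'rV[R]_p) : 'rV[R]_(1 + n) :=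
  (row i \o vec_mx) u.

Lemma block_odd_map i y : block i (odd_map y) = odd_coord (b i) y.
Proof.
rewrite /block /odd_map -linear_sum /= mxvecK; apply/rowP => k.
rewrite !mxE summxE (bigD1 i) //= big1 => [|j ji].
  by rewrite addr0 !mxE big_ord1 !mxE !eqxx mul1r.
by rewrite !mxE big_ord1 !mxE eq_sym (negbTE ji) mul0r.
Qed.

Lemma block_differentiable i u : differentiable (block i) u.
Proof.
by apply: (@linear_differentiable _ _ _ (row i \o vec_mx));
  exact: linear_rV_continuous.
Qed.

Lemma odd_map_swap y : odd_map (cover_swap y) = - odd_map y.
Proof.
rewrite /odd_map -sumrN; apply: eq_bigr => i _.
by rewrite odd_coord_swap mulmxN linearN.
Qed.

Lemma odd_map_Ck (d : chart R n M) (sd : smooth_chart d) k :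
  Ck_on k (d @` chart_dom d) (odd_map \o chart_inv (lift_chart sd)).
Proof.
have oimg : open (d @` chart_dom d) by exact: chart_img_open.
have -> : odd_map \o chart_inv (lift_chart sd) =
    \sum_i ((mxvec \o mulmx (delta_mx i (0 : 'I_1))) \o
      (odd_coord (b i) \o chart_inv (lift_chart sd))).
  by apply/funext => q; rewrite fct_sumE.
apply: Ck_on_sum => // i _.
exact (Ck_on_linear_rV (mxvec \o mulmx (delta_mx i (0 : 'I_1))) oimg
  (odd_coord_Ck i0 (b i) sd k)).
Qed.

Lemma odd_map_separation i y y' : 0 < b i y.1 ->
  0 < odd_coord (b i) y 0 (lshift n 0) * block i (odd_map y') 0 (lshift n 0) ->
  [/\ 0 < b i y'.1, odd_sign (b i) y' = odd_sign (b i) y &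
      dehom (block i (odd_map y')) = bump_chart (b i) y'.1].
Proof.
rewrite block_odd_map => by0 /(odd_coord_head_mul_gt0 by0)[by'0 ->].
by rewrite dehom_odd_coord.
Qed.

Lemma odd_map_inj : injective odd_map.
Proof.
move=> y y' yy'; have [i by0] := b_cover y.1.
have [|by'0 ss' dE] := @odd_map_separation i y y' by0.
  (* Since the images coincide, the product of the two heads is a nonzero square. *)
  rewrite -yy' block_odd_map -expr2.
  by rewrite exprn_even_gt0 //= odd_coord_head_neq0.
move: dE; rewrite -yy' block_odd_map dehom_odd_coord // => cE.
have xx' : y.1 = y'.1.
  rewrite -(chartK (bump_gt0_dom by0)) cE chartK //; exact: bump_gt0_dom.
move: ss'; rewrite /odd_sign -xx' => /addIb.
by case: y y' xx' {yy' by0 by'0 cE} => x o [x' o'] /= -> ->.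
Qed.

Lemma odd_map_open (A : set (orcover M)) : open A ->
  exists2 B, open B & A = odd_map @^-1` B.
Proof.
move=> oA; pose c i := bump_chart (b i).
have sc i : smooth_chart (c i) by exact/smooth_chart_atlas/bump_chart_atlas.
(* The part of the base that the sheet of the chart flipped by [s] sends into [A]. *)
pose W i s := [set x | chart_dom (flip_chart i0 s (c i)) x /\
  A (sheet (flip_chart i0 s (c i)) x)].
have oW i s : open (W i s) by apply: oA; exact: flip_chart_smooth.
(* A vector lies in [B i y] if its [i]-th head has the same sign as at [y] and its affine
   coordinates are those of a point of [W]. *)
pose B i y := [set u | 0 < odd_coord (b i) y 0 (lshift n 0) *
    block i u 0 (lshift n 0) /\
  ((c i) @` (chart_dom (c i) `&` W i (odd_sign (b i) y))) (dehom (block i u))].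
exists (\bigcup_(k in [set k : 'I_N * orcover M | A k.2 /\ 0 < b k.1 k.2.1])
    B k.1 k.2).
  apply: bigcup_open => -[i y] /= [Ay by0].
  rewrite openE => u [head0 Wu].
  have uneq0 : block i u 0 (lshift n 0) != 0.
    by apply/eqP => u0; move: head0; rewrite u0 mulr0 ltxx.
  have block_cont := differentiable_continuous (block_differentiable i u).
  have dehom_cont := differentiable_continuous (dehom_differentiable uneq0).
  have head_cont : {for u, continuous (fun v =>
      odd_coord (b i) y 0 (lshift n 0) * block i v 0 (lshift n 0))}.
    apply: continuousM; first exact: cst_continuous.
    exact: (continuous_comp block_cont
      (@coord_continuous R 1 (1 + n) 0 (lshift n 0) (block i u))).
  have near_head : \forall v \near u, 0 < odd_coord (b i) y 0 (lshift n 0) *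
      block i v 0 (lshift n 0) by exact: (head_cont _ (lt_nbhsr head0)).
  have oimg := @chart_image_open _ _ _ (c i) _ (oW i (odd_sign (b i) y)).
  have near_W : \forall v \near u, (c i @` (chart_dom (c i) `&`
      W i (odd_sign (b i) y))) (dehom (block i v)).
    exact: (continuous_comp block_cont dehom_cont
      (open_nbhs_nbhs (conj oimg Wu))).
  by apply: filterS2 near_head near_W => v hv Wv; split.
apply/seteqP; split=> [y Ay|y' [[i y] /= [Ay by0] [head0 Wy']]].
  have [i by0] := b_cover y.1; exists (i, y) => //=; split.
    by rewrite block_odd_map -expr2 exprn_even_gt0 //= odd_coord_head_neq0.
  rewrite block_odd_map dehom_odd_coord //.
  have cy := bump_gt0_dom by0; exists y.1 => //; split=> //.
  split; first by rewrite flip_chart_dom.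
  by rewrite lift_dom_sheet //; exact: (lift_dom_flip i0 (sc i) cy).
(* Equal signs mean that the same flipped chart serves at [y] and [y'], so its sheet over [y'.1]
   passes through [y'], which therefore lies in [A]. *)
have [by'0 ss' dE] := odd_map_separation by0 head0.
move: Wy'; rewrite dE => -[x [cx [_ Ax]] cxE].
have cy' := bump_gt0_dom by'0.
have xE : x = y'.1 by rewrite -(chartK cx) cxE chartK.
move: Ax; rewrite xE -ss' lift_dom_sheet //.
exact: (lift_dom_flip i0 (sc i) cy').
Qed.

(** A differentiable local left inverse gives, by the chain rule, a left inverse of the
    differential. *)
Lemma odd_map_immersion (d : chart R n M) (sd : smooth_chart d) x :
  chart_dom d x ->
  injective ('d (odd_map \o chart_inv (lift_chart sd)) (d x)).
Proof.
move=> dx; have [i bx0] := b_cover x.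
have cx := bump_gt0_dom bx0; set c := bump_chart (b i) in cx.
have sc : smooth_chart c by exact/smooth_chart_atlas/bump_chart_atlas.
set f := odd_map \o _.
(* Recovers the coordinates in the bump chart from the [i]-th block, then changes to the chart
   [d]. *)
pose g := transition c d \o (dehom \o block i).
have fE z : chart_dom d z -> block i (f (d z)) = odd_coord (b i) (sheet d z).
  move=> dz; rewrite -block_odd_map; congr (block i (odd_map _)).
  by rewrite /= chartK.
have df : differentiable f (d x) by apply: (odd_map_Ck sd 1).1; exists x.
have dg : differentiable g (f (d x)).
  apply: differentiable_comp.
    apply: differentiable_comp; first exact: block_differentiable.
    by apply: dehom_differentiable; rewrite fE // odd_coord_head_neq0.
  rewrite /= fE // dehom_odd_coord //.
  exact: smooth_transition_differentiable (smooth_chart_transition sc sd) cx dx.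
have near_gf : {near d x, g \o f =1 id}.
  have oV := @chart_image_open _ _ _ d _ (bump_gt0_open (b i)).
  have Vx : (d @` (chart_dom d `&` [set x | 0 < b i x])) (d x) by exists x.
  apply: filterS (open_nbhs_nbhs (conj oV Vx)) => _ [z [dz bz0] <-].
  rewrite -[LHS]/(transition c d (dehom (block i (f (d z))))) fE //.
  rewrite dehom_odd_coord // transitionE //.
  exact: bump_gt0_dom.
have left_inv v : 'd g (f (d x)) ('d f (d x) v) = v.
  have dgf := differentiable_comp df dg.
  have := near_eq_derive v near_gf.
  rewrite derive_id (deriveE _ dgf) (diff_comp df dg); exact.
by move=> v w vw; rewrite -(left_inv v) vw left_inv.
Qed.

End embedding.

(** * The double covering *)

Section cover_manifold.
Context {R : realType} {n : nat} {M : smoothManifold R n} (i0 : 'I_n).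
Context (M_compact : compact [set: M]).

Lemma compact_orcover_second_countable : second_countable (T := orcover M).
Proof.
have [N [b b_cover]] := finite_bumps M_compact.
apply: (@orcover_second_countable _ _ _ i0 N (fun i => bump_chart (b i)))
  => [i|x].
  exact/smooth_chart_atlas/bump_chart_atlas.
by have [i bx] := b_cover x; exists i; exact: bump_gt0_dom.
Qed.

Definition cover_manifold : smoothManifold R n :=
  SmoothManifold (orcover_hausdorff (M := M) i0) compact_orcover_second_countable
    (lift_atlas_cover i0) (@lift_atlas_compatible R n M).

Lemma cover_manifold_orientable : orientable cover_manifold.
Proof.
exists (@lift_atlas R n M); split; [|exact: lift_atlas_cover|].
  by move=> C aC D aD; split; exact: lift_atlas_compatible.
move=> _ _ y [c [sc ->]] [d [sd ->]] yc yd; exact: (lift_dom_or sc sd yc yd).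
Qed.

(** The inverse is [sheet c]. In lifted charts both maps are transitions of [M]. *)
Lemma cover_proj_diffeomorphism c : smooth_chart c ->
  @diffeomorphism_on R n n cover_manifold M (lift_dom c) (chart_dom c)
    (@cover_proj R n M).
Proof.
move=> sc; exists (sheet c); split.
- split=> [y _|_ d [c' [sc' ->]] ad k]; first exact: cover_proj_continuous.
  have sd := smooth_chart_atlas ad.
  apply: Ck_on_sub (smooth_chart_transition sc' sd k).
  by move=> _ [y [[_ [c'y _]] dy] <-]; exists y.1.
- split=> [x cx|c' _ ac' [d [sd ->]] k]; first exact: sheet_continuous.
  have sc' := smooth_chart_atlas ac'.
  apply: Ck_on_sub (smooth_chart_transition sc' sd k).
  by move=> _ [x [[_ c'x] [dx _]] <-]; exists x.
- by move=> y yc; split; [case: yc|exact: lift_dom_sheet].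
- by move=> x cx; split.
Qed.

Lemma cover_proj_double_covering :
  @double_covering R n cover_manifold M (@cover_proj R n M).
Proof.
move=> x; have [c ac cx] := atlas_cover x.
have sc := smooth_chart_atlas ac; have src := refl_chart_smooth i0 sc.
exists (chart_dom c), (lift_dom c), (lift_dom (refl_chart i0 c)); split.
- by split; [exact: chart_dom_open|].
- by split; exact: lift_dom_open.
- apply/seteqP; split=> // y [[cy yc] [_]].
  by rewrite chart_or_refl // yc; case: chart_or.
- apply/seteqP; split=> [y cy|y [[]|[]] //].
  (* The correcting bit tells which of the two lifts contains [y]. *)
  have := lift_dom_flip i0 sc cy; case: (_ (+) _); [by right|by left].
- split; first exact: cover_proj_diffeomorphism.
  exact: (cover_proj_diffeomorphism src).
Qed.

Lemma cover_swap_deck :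
  @deck_transformation cover_manifold M (@cover_proj R n M) (@cover_swap R n M).
Proof.
split; last by [].
exists (@cover_swap R n M); split; [| |exact: cover_swapK|exact: cover_swapK];
  exact: cover_swap_continuous.
Qed.

(** The base points whose fibre is fixed by [d] form an open and closed set, which connectedness
    forces to be everything or empty. *)
Lemma cover_deck_unique (d : cover_manifold -> cover_manifold) :
  connected [set: M] ->
  @deck_transformation cover_manifold M (@cover_proj R n M) d ->
  d = id \/ d = @cover_swap R n M.
Proof.
move=> cM [[e [cd ce deK edK]] pd].
have d1 y : (d y).1 = y.1 by exact: (congr1 (fun f => f y) pd).
have d_dich y : d y = y \/ d y = cover_swap y.
  case: y (d1 y) => x o; case: (d _) => x' o' /= ->.
  by rewrite /cover_swap /=; case: o o' => -[]; [left|right|right|left].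
have swap_neq (y : orcover M) : cover_swap y <> y.
  by case: y => x [].
(* By injectivity, [d] cannot send both points of a fibre to [y]. *)
have dfix_swap y : d y = y -> d (cover_swap y) = cover_swap y.
  move=> dy; have [//|] := d_dich (cover_swap y).
  by rewrite cover_swapK -{2}dy => /(can_inj deK) /swap_neq.
have fixP (x : M) o o' : d (x, o) = (x, o) -> d (x, o') = (x, o').
  move=> dx; have [<- //|oo'] := eqVneq o o'.
  have -> : (x, o') = cover_swap (x, o) :> orcover M.
    by rewrite /cover_swap /=; case: o o' oo' {dx} => -[].
  exact: dfix_swap.
(* The choice of [true] is immaterial: by [fixP], one fixed point in a fibre means that both are
   fixed. *)
pose S : set M := [set x | d (x, true) = (x, true)].
have SP c x : S x <-> d (sheet c x) = sheet c x by split; exact: fixP.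
have swapP c x : ~ S x <-> d (sheet c x) = cover_swap (sheet c x).
  rewrite (SP c x); split=> [|->]; last exact: swap_neq.
  by have [] := d_dich (sheet c x).
have near_sheet c x (U : set (orcover M)) : smooth_chart c -> chart_dom c x ->
    open U -> U (d (sheet c x)) -> \forall y \near x, U (d (sheet c y)).
  move=> sc cx oU Ux.
  exact: (continuous_comp (sheet_continuous sc cx) (cd _)
    (open_nbhs_nbhs (conj oU Ux))).
have oS : open S.
  rewrite openE => x Sx; have [c ac cx] := atlas_cover x.
  have sc := smooth_chart_atlas ac.
  have near_d : \forall y \near x, lift_dom c (d (sheet c y)).
    apply: near_sheet => //; first exact: lift_dom_open.
    by rewrite ((SP c x).1 Sx).
  apply: filterS near_d => y [_]; rewrite d1 /= => dy2; apply/(SP c).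
  by case: (d _) (d1 (sheet c y)) dy2 => x' o' /= -> ->.
have oSc : open (~` S).
  rewrite openE => x Sx; have [c ac cx] := atlas_cover x.
  have sc := smooth_chart_atlas ac.
  (* Where [d] swaps the fibre, it carries the sheet of [c] into the open lift of the reflected
     chart, and by continuity it does so nearby. *)
  have near_d : \forall y \near x, lift_dom (refl_chart i0 c) (d (sheet c y)).
    apply: near_sheet => //; first exact/lift_dom_open/refl_chart_smooth.
    by rewrite ((swapP c x).1 Sx) -(sheet_refl i0 sc cx).
  apply: filterS near_d => y [cy]; rewrite d1 /= in cy *.
  rewrite chart_or_refl // => dy2; apply/(swapP c).
  by case: (d _) (d1 (sheet c y)) dy2 => x' o' /= -> ->.
have [[x0 Sx0]|S0] := pselect (S !=set0).
  left; have ST : S = setT.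
    apply: cM; first by exists x0.
      by exists S; rewrite ?setTI.
    by exists S; rewrite ?setTI // -[S]setCK; exact: open_closedC.
  have allS x : S x by rewrite ST.
  by apply/funext => -[x o]; exact: fixP (allS x).
right; apply/funext => y; have [dy|//] := d_dich y.
exfalso; apply: S0; exists y.1; apply: (@fixP _ y.2); by case: y dy.
Qed.

End cover_manifold.

Theorem corollaryD1 (R : realType) (n : nat) (M : smoothManifold R n)
    (g : riemannian_metric M)
    (M_compact : compact [set: M])
    (M_connected : connected [set: M])
    (M_nonorientable : ~ orientable M) :
  exists (Mt : smoothManifold R n) (pi : Mt -> M) (z : Mt -> Mt),
    [/\ orientable Mt,
        double_covering pi,
        deck_transformation pi z /\ z <> id,
        forall d : Mt -> Mt, deck_transformation pi d -> d = id \/ d = z &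
        exists (p : nat) (Phi : Mt -> 'rV[R]_p),
          smooth_embedding Phi /\ forall x : Mt, Phi (z x) = - Phi x].
Proof.
(* The index [i0] is the coordinate to reflect, and [x0] witnesses that the swap is not the
   identity. They exist because the atlas would orient [M] vacuously if [M] were empty, and in
   dimension 0 because empty determinants are 1. *)
have [i0 [x0 _]] : exists (i : 'I_n) (x : M), True.
  apply: contrapT => no_pt; apply: M_nonorientable.
  exists (@atlas R n M); split; [exact: smooth_chart_atlas|exact: atlas_cover|].
  move=> c d x _ _ _ _; have [n0|n_gt0] := posnP n; last first.
    by exfalso; apply: no_pt; exists (Ordinal n_gt0), x.
  have det_mx0 m (A : 'M[R]_m) : m = 0%N -> \det A = 1.
    by case: m A => // A _; exact: det_mx00.
  by rewrite det_mx0.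
have [N [b b_cover]] := finite_bumps M_compact.
exists (cover_manifold i0 M_compact), (@cover_proj R n M), (@cover_swap R n M).
split.
- exact: cover_manifold_orientable.
- exact: cover_proj_double_covering.
- split; first exact: cover_swap_deck.
  by move=> /(congr1 (fun f => f (x0, true))).
- by move=> d; exact: cover_deck_unique.
- exists (N * (1 + n))%N, (odd_map b); split; last exact: odd_map_swap.
  split.
  + by move=> _ [c [sc ->]] k; rewrite lift_image; exact: odd_map_Ck.
  + by move=> _ x [c [sc ->]] [cx _]; exact: odd_map_immersion.
  + exact: odd_map_inj.
  + exact: odd_map_open.
Qed.
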